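(* Let $K$ be a field of characteristic zero, $R=K[x,y,z]$ with the standard grading, and let $a,b,c,\beta,\gamma$ be integers with $a\geq c\geq 2$, $1\leq \beta\leq b-1$ and $\max\{1,b-a+1\}\leq \gamma\leq \min\{b-1,c-1\}$. Consider the ideal $$I=(x^a,\ y^b-x^{b-\gamma}z^\gamma,\ z^c,\ x^{a-b+\gamma}y^{b-\beta},\ y^{b-\beta}z^{c-\gamma})\subset R.$$ If one of $a,b,c$ is equal to four, then $R/I$ has the weak Lefschetz property.
   Context: A graded Artinian $K$-algebra $A=\bigoplus_i [A]_i$ has the weak Lefschetz property (WLP) if there exists a linear form $L\in[A]_1$ such that the multiplication map $\times L:[A]_i\to[A]_{i+1}$ has maximal rank (i.e. is injective or surjective) for every $i$. *)

(* Defs.v *)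
From HB Require Import structures.
From mathcomp Require Import all_boot all_order all_algebra.
From mathcomp Require Export mpoly.
Set Implicit Arguments. Unset Strict Implicit. Unset Printing Implicit Defensive.
Import GRing.Theory.
Local Open Scope ring_scope.

Definition in_ideal (K : fieldType) (n k : nat) (gs : k.-tuple {mpoly K[n]})
  (f : {mpoly K[n]}) : Prop :=
  exists q : 'I_k -> {mpoly K[n]}, f = \sum_(j < k) q j * tnth gs j.

(* A = R/I, R = K[X_0..X_{n-1}] standard graded, I = (gs) homogeneous.
   [A]_i = R_i / I_i with I_i = I ∩ R_i.  The multiplication map
   x L : [A]_i -> [A]_{i+1} induced by a linear form L.                *)
Definition mult_injective (K : fieldType) (n k : nat) (gs : k.-tuple {mpoly K[n]})
  (L : {mpoly K[n]}) (i : nat) : Prop :=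
  forall f : {mpoly K[n]}, f \is i.-homog ->
    in_ideal gs (L * f) -> in_ideal gs f.

Definition mult_surjective (K : fieldType) (n k : nat) (gs : k.-tuple {mpoly K[n]})
  (L : {mpoly K[n]}) (i : nat) : Prop :=
  forall g : {mpoly K[n]}, g \is i.+1.-homog ->
    exists2 f : {mpoly K[n]}, f \is i.-homog & in_ideal gs (g - L * f).

Definition has_WLP (K : fieldType) (n k : nat) (gs : k.-tuple {mpoly K[n]}) : Prop :=
  exists2 L : {mpoly K[n]}, L \is 1.-homog &
    forall i : nat, mult_injective gs L i \/ mult_surjective gs L i.

Definition thm_gens (K : fieldType) (a b c beta gamma : nat) : 5.-tuple {mpoly K[3]} :=
  let x : {mpoly K[3]} := 'X_(inord 0) in
  let y : {mpoly K[3]} := 'X_(inord 1) in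
  let z : {mpoly K[3]} := 'X_(inord 2) in
  [tuple x ^+ a;
         y ^+ b - x ^+ (b - gamma) * z ^+ gamma;
         z ^+ c;
         x ^+ (a + gamma - b) * y ^+ (b - beta);
         y ^+ (b - beta) * z ^+ (c - gamma)].

(* Main.v *)
Require Import Defs.
From HB Require Import structures.
From mathcomp Require Import all_boot all_order all_algebra.
From mathcomp Require Import mpoly.
From mathcomp Require Import zify ring.
Set Implicit Arguments. Unset Strict Implicit. Unset Printing Implicit Defensive.
Import GRing.Theory.
Local Open Scope ring_scope.

(* Put u = b - gamma, v = gamma, p + 1 = a - u, q + 1 = b - beta and
   r + 1 = c - gamma.  The generators form a Groebner basis with leading term
   y ^ b of the binomial, so A = R/I has a monomial basis; it is the union of
   the boxes Q = {i < a, j <= q, k < c} and M = {i <= p, q < j < b, k <= r}.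
   The degrees of both boxes are symmetric about (p + q + r + u + v) / 2, half
   the socle degree of A.  Hence the operator x + y + z computed inside each
   box separately (two monomial complete intersections) has maximal rank in
   every degree, by an sl_2 argument.
   Take L = z0 ^ u (z0 ^ 2 x + y + z) for a scalar z0, and rescale the basis by
   suitable powers of z0: multiplication by L becomes z0 ^ u E + N, where E is
   that box-diagonal operator and N (the passages between the boxes) does not
   depend on z0.  So L has maximal rank for all but finitely many values of
   z0 ^ u. *)

(** * Monomial complete intersections in three variables *)

Section Box.
Variable K : fieldType.
Hypothesis charK : [pchar K] =i pred0.
Implicit Types g : nat -> nat -> nat -> K.

Lemma natrK_eq0 n : (n%:R == 0 :> K) = (n == 0%N).
Proof. by move/pcharf0P: charK. Qed.

(** The transpose, in the monomial basis, of multiplication by [x + y + z]; it serves as the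
    lowering operator of an sl_2 action. *)
Definition contract g i j k : K := g i.+1 j k + g i j.+1 k + g i j k.+1.

(** The factor [i * (m - i)] vanishes at [i = 0] and at [i = m], so the default [0.-1 = 0] is
    harmless and support in the box is preserved. *)
Definition raise (m n l : nat) g i j k : K :=
  i%:R * (m%:R - i%:R) * g i.-1 j k + j%:R * (n%:R - j%:R) * g i j.-1 k
  + k%:R * (l%:R - k%:R) * g i j k.-1.

(** The sl_2 commutation relation. In one variable it is [(i + 1) * (m - i - 1) - i * (m - i) = m -
    1 - 2 * i]; the three variables add up. *)
Lemma contract_raise m n l g i j k :
  contract (raise m n l g) i j k = raise m n l (contract g) i j k
    + ((m + n + l)%:R - (3 + 2 * (i + j + k))%:R) * g i j k.
Proof.
rewrite /contract /raise.
case: i => [|i]; case: j => [|j]; case: k => [|k] /=;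
  rewrite ?natrD ?natrM ?natrD -?natr1; ring.
Qed.

Definition box_supported (m n l D : nat) g := forall i j k,
  ~~ [&& i < m, j < n, k < l & i + j + k == D]%N -> g i j k = 0.

Lemma raise_supported m n l D g :
  box_supported m n l D g -> box_supported m n l D.+1 (raise m n l g).
Proof.
have z0 (x y : nat) : (x == 0%N) || (x == y) -> x%:R * (y%:R - x%:R) = 0 :> K.
  by case/orP=> /eqP->; rewrite ?mul0r // subrr mulr0.
move=> sg i j k out; rewrite /raise.
have tx : i%:R * (m%:R - i%:R) * g i.-1 j k = 0.
  have [h|h] := boolP ((i == 0%N) || (i == m)); first by rewrite z0 ?mul0r.
  by rewrite sg ?mulr0 //; lia.
have ty : j%:R * (n%:R - j%:R) * g i j.-1 k = 0.
  have [h|h] := boolP ((j == 0%N) || (j == n)); first by rewrite z0 ?mul0r.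
  by rewrite sg ?mulr0 //; lia.
have tz : k%:R * (l%:R - k%:R) * g i j k.-1 = 0.
  have [h|h] := boolP ((k == 0%N) || (k == l)); first by rewrite z0 ?mul0r.
  by rewrite sg ?mulr0 //; lia.
by rewrite tx ty tz !addr0.
Qed.

(* [contract], [raise] and the degree span an sl_2: commuting [contract] past the
   powers of [raise] produces only nonzero scalars above the middle degree. *)
Lemma contract_injective m n l D g :
  box_supported m n l D g -> (m + n + l < 2 * D + 3)%N ->
  (forall i j k, contract g i j k = 0) -> forall i j k, g i j k = 0.
Proof.
move=> sg hD g0; pose v s := iter s (raise m n l) g.
have vS s : v s.+1 = raise m n l (v s) by [].
have sv s : box_supported m n l (D + s) (v s).
  elim: s => [|s IH]; first by rewrite addn0.
  by rewrite addnS; apply: raise_supported.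
(* [- kap] is the sl_2 weight [m + n + l - 3 - 2 * D] of [g]; the degree bound makes [kap]
   positive. *)
pose kap := (2 * D + 3 - (m + n + l))%N.
have hE : (2 * D + 3 = kap + (m + n + l))%N by rewrite /kap; lia.
have kap_gt0 : (0 < kap)%N by rewrite /kap; lia.
(* Closed form of the recursion [C 1 = kap], [C (s + 2) = C (s + 1) + kap + 2 * (s + 1)] that each
   further commutation produces. It is positive for [s > 0]. *)
pose C s := (s * (kap + s).-1)%N.
have step s i j k : contract (v s.+1) i j k = - (C s.+1)%:R * v s i j k.
  elim: s i j k => [|s IH] i j k.
    rewrite vS contract_raise {1}/raise !g0 !mulr0 !add0r.
    have [/and4P[_ _ _ /eqP dijk]|out] :=
      boolP [&& i < m, j < n, k < l & i + j + k == D]%N; last by rewrite /= sg // !mulr0.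
    have -> : (3 + 2 * (i + j + k) = kap + (m + n + l))%N by rewrite dijk; lia.
    have -> : C 1 = kap by rewrite /C; lia.
    by rewrite natrD /=; ring.
  rewrite [v s.+2]vS contract_raise.
  have -> : raise m n l (contract (v s.+1)) i j k = - (C s.+1)%:R * v s.+1 i j k.
    by rewrite {1}/raise !IH vS /raise; ring.
  have [/and4P[_ _ _ /eqP dijk]|out] :=
    boolP [&& i < m, j < n, k < l & i + j + k == D + s.+1]%N; last by rewrite sv // !mulr0 addr0.
  have -> : (3 + 2 * (i + j + k) = kap + (m + n + l) + 2 * s.+1)%N by rewrite dijk; lia.
  have -> : C s.+2 = (C s.+1 + kap + 2 * s.+1)%N by rewrite /C; lia.
  by rewrite !natrD; ring.
have vanish s : (forall i j k, v s i j k = 0) -> forall i j k, g i j k = 0.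
  elim: s => [//|s IH] vs; apply: IH => i j k.
  have := step s i j k; rewrite {1}/contract !vs !addr0 => /esym/eqP.
  rewrite mulf_eq0 oppr_eq0 natrK_eq0 => /orP[|/eqP //].
  by rewrite /C muln_eq0 /=; lia.
(* Degree [D + (m + n + l)] lies beyond the box, so this iterate is zero; [vanish] then descends to
   [g]. *)
apply: (vanish (m + n + l)%N) => i j k; apply: sv; lia.
Qed.

Definition mulxyz g i j k : K :=
  (if i is i'.+1 then g i' j k else 0) + (if j is j'.+1 then g i j' k else 0)
  + (if k is k'.+1 then g i j k' else 0).

(** Reversing exponents, [i] to [m - 1 - i] and so on, turns multiplication by [x + y + z] into
    [contract] and degree [D] into [m + n + l - 3 - D]. *)
Lemma mulxyz_injective m n l D g :
  box_supported m n l D g -> (2 * D + 3 < m + n + l)%N ->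
  (forall i j k, (i < m)%N -> (j < n)%N -> (k < l)%N -> mulxyz g i j k = 0) ->
  forall i j k, g i j k = 0.
Proof.
move=> sg hD g0.
(* The guard matters: truncated subtraction would otherwise read boundary values of [g] at indices
   outside the box. *)
pose g' i j k := if [&& i < m, j < n & k < l]%N
  then g (m.-1 - i)%N (n.-1 - j)%N (l.-1 - k)%N else 0.
have g'0 : forall i j k, g' i j k = 0.
  apply: (@contract_injective m n l (m + n + l - 3 - D)); last 1 first.
  - move=> i j k; rewrite /contract /g'.
    have [/and3P[im jn kl]|out] := boolP [&& i < m, j < n & k < l]%N; last first.
      do 3 (rewrite ifF; last by apply: contraNF out; lia). by rewrite !addr0.
    rewrite -[RHS](g0 (m.-1 - i)%N (n.-1 - j)%N (l.-1 - k)%N); try lia.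
    rewrite /mulxyz im jn kl /= !andbT.
    congr (_ + _ + _).
    + case: (ltnP i.+1 m) => h.
        by have -> : (m.-1 - i = (m.-1 - i.+1).+1)%N by lia.
      by have -> : (m.-1 - i = 0)%N by lia.
    + case: (ltnP j.+1 n) => h.
        by have -> : (n.-1 - j = (n.-1 - j.+1).+1)%N by lia.
      by have -> : (n.-1 - j = 0)%N by lia.
    + case: (ltnP k.+1 l) => h.
        by have -> : (l.-1 - k = (l.-1 - k.+1).+1)%N by lia.
      by have -> : (l.-1 - k = 0)%N by lia.
  - move=> i j k; rewrite /g'; case: ifP => // /and3P[im jn kl] out.
    by apply: sg; lia.
  - lia.
move=> i j k.
have [/and3P[im jn kl]|out] := boolP [&& i < m, j < n & k < l]%N; last by apply: sg; lia.
have := g'0 (m.-1 - i)%N (n.-1 - j)%N (l.-1 - k)%N.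
rewrite /g' ifT; last lia.
by have [-> -> ->] : [/\ m.-1 - (m.-1 - i) = i, n.-1 - (n.-1 - j) = j &
  l.-1 - (l.-1 - k) = k]%N by split; lia.
Qed.

(** The parameter must be a [u]-th power, since it arises as a power of the scalar in the linear
    form. In characteristic zero [1 ^ u], [2 ^ u], ... are distinct, so [size P] of them cannot all
    be roots. *)
Lemma natrX_nonroot (u : nat) (P : {poly K}) : (0 < u)%N -> P != 0 ->
  exists2 s : K, s != 0 & ~~ root P (s ^+ u).
Proof.
move=> u0 P0; pose rs := [seq (x.+1 ^ u)%:R : K | x <- iota 0 (size P)].
have urs : uniq rs.
  rewrite map_inj_uniq ?iota_uniq // => x y.
  wlog le_xy : x y / (x <= y)%N.
    by move=> W; case: (leqP x y) => [|/ltnW] h; [exact: W | move=> /esym/W->].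
  have le_pow : (x.+1 ^ u <= y.+1 ^ u)%N by rewrite leq_exp2r.
  move=> /esym/eqP; rewrite -subr_eq0 -natrB // natrK_eq0 subn_eq0.
  by rewrite leq_exp2r // => ?; apply/eqP; rewrite eqn_leq le_xy.
have /allPn[_ /mapP[x _ ->] nr] : ~~ all (root P) rs.
  by apply/negP=> /(max_poly_roots P0)/(_ urs); rewrite size_map size_iota ltnn.
by exists x.+1%:R; rewrite ?natrK_eq0 // -natrX.
Qed.
End Box.

(** * Pencils of matrices indexed by finite sequences *)

Section Pencil.
Variables (K : fieldType) (T : eqType).

(** Row-vector convention: rows index the source, so injective maps are [row_free] and surjective
    ones [row_full]. *)
Definition tabulate (A B : seq T) (X : T -> T -> K) : 'M[K]_(size A, size B) :=
  \matrix_(i, j) X (tnth (in_tuple A) i) (tnth (in_tuple B) j).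

Definition pencil (X Y : T -> T -> K) (t : K) s s' := t * X s s' + Y s s'.

Lemma tabulate_pencil A B X Y t :
  tabulate A B (pencil X Y t) = t *: tabulate A B X + tabulate A B Y.
Proof. by apply/matrixP=> i j; rewrite !mxE. Qed.

(** If [X B = 1], then [(t X + Y) B = t + Y B] is invertible unless [t] is an eigenvalue of [- Y B];
    so the characteristic polynomial of [- Y B] works. *)
Lemma row_free_pencil m n (X Y : 'M[K]_(m, n)) : row_free X ->
  exists2 P : {poly K}, P != 0 & forall t, ~~ root P t -> row_free (t *: X + Y)%R.
Proof.
case/row_freeP=> B XB; exists (char_poly (- (Y *m B))).
  by rewrite monic_neq0 ?char_poly_monic.
move=> t; rewrite -eigenvalue_root_char => /eigenvalueP nt.
apply: inj_row_free => w wXY; apply/eqP; apply: contra_notT nt => w0.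
exists w => //; apply/eqP; rewrite -subr_eq0 mulmxN -opprD oppr_eq0.
have := congr1 (mulmx^~ B) wXY; rewrite mul0mx mulmxDr mulmxDl -!mulmxA.
by rewrite -scalemxAl XB scalemx1 mul_mx_scalar addrC => ->.
Qed.

Lemma row_full_pencil m n (X Y : 'M[K]_(m, n)) : row_full X ->
  exists2 P : {poly K}, P != 0 & forall t, ~~ root P t -> row_full (t *: X + Y)%R.
Proof.
move=> fX; have : row_free X^T by rewrite /row_free mxrank_tr.
move=> /(row_free_pencil Y^T)[P P0 h]; exists P; first exact: P0.
move=> t /h.
by rewrite -linearZ -linearD /row_free mxrank_tr.
Qed.

Lemma extend_row A (c : 'rV[K]_(size A)) : uniq A ->
  exists g : T -> K, forall k, g (tnth (in_tuple A) k) = c 0 k.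
Proof.
move=> uA; exists (fun s => \sum_k c 0 k * (tnth (in_tuple A) k == s)%:R) => k.
rewrite (bigD1 k) //= eqxx mulr1 big1 ?addr0 // => k' kk'.
by rewrite (inj_eq (tuple_uniqP _ _)) // (negPf kk') mulr0.
Qed.

Lemma row_free_tabulate (A B : seq T) X : uniq A ->
  row_free (tabulate A B X) <->
  (forall g, (forall s', s' \in B -> \sum_(s <- A) g s * X s s' = 0) ->
     forall s, s \in A -> g s = 0).
Proof.
move=> uA; split=> [fX g gX s sA|inj].
  pose w : 'rV[K]_(size A) := \row_i g (tnth (in_tuple A) i).
  have : w = 0.
    apply: (row_free_inj fX); rewrite mul0mx; apply/rowP=> j; rewrite !mxE.
    rewrite -[RHS](gX _ (mem_tnth j (in_tuple B))) (big_tnth _ _ A).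
    by apply: eq_bigr => i _; rewrite !mxE.
  have /tnthP[i ->] : s \in in_tuple A by [].
  by move/rowP/(_ i); rewrite !mxE.
apply: inj_row_free => w wX; apply/rowP=> i; rewrite mxE.
have [g gE] := extend_row w uA.
rewrite -gE; apply: inj; last exact: mem_tnth.
move=> s' s'B; have /tnthP[j ->] : s' \in in_tuple B by [].
have /rowP/(_ j) := wX; rewrite !mxE (big_tnth _ _ A) => wXj; rewrite -[RHS]wXj.
by apply: eq_bigr => k _; rewrite gE mxE.
Qed.

(** Surjectivity is checked dually, as injectivity of the transpose. *)
Lemma row_full_tabulate (A B : seq T) X : uniq B ->
  (forall h, (forall s, s \in A -> \sum_(s' <- B) X s s' * h s' = 0) ->
     forall s', s' \in B -> h s' = 0) ->
  row_full (tabulate A B X).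
Proof.
move=> uB inj; rewrite /row_full -mxrank_tr.
have -> : (tabulate A B X)^T = tabulate B A (fun s' s => X s s').
  by apply/matrixP=> i j; rewrite !mxE.
apply/(row_free_tabulate _ _ uB) => g gX; apply: inj => s sA.
by rewrite -[RHS](gX s sA); apply: eq_bigr => i _; rewrite mulrC.
Qed.

Lemma row_full_solve (A B : seq T) X w : uniq A -> row_full (tabulate A B X) ->
  exists g, forall s', s' \in B -> \sum_(s <- A) g s * X s s' = w s'.
Proof.
move=> uA /row_fullP[Y YX].
pose c : 'rV[K]_(size A) := (\row_j w (tnth (in_tuple B) j)) *m Y.
have [g gE] := extend_row c uA.
exists g => s' s'B; have /tnthP[j ->] : s' \in in_tuple B by [].
have := congr1 (fun Z => (\row_j w (tnth (in_tuple B) j) *m Z) 0 j) YX.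
rewrite mulmxA -/c mulmx1 !mxE => <-; rewrite (big_tnth _ _ A).
by apply: eq_bigr => k _; rewrite gE [tabulate _ _ _ _ _]mxE.
Qed.

End Pencil.

Local Notation expo := (nat * nat * nat)%type.

(** * The monomial basis and its two boxes *)

Section Blocks.
Variables (K : fieldType) (p q r u v w : nat).

Definition deg (t : expo) := (t.1.1 + t.1.2 + t.2)%N.
Definition incx (t : expo) : expo := (t.1.1.+1, t.1.2, t.2).
Definition incy (t : expo) : expo := (t.1.1, t.1.2.+1, t.2).
Definition incz (t : expo) : expo := (t.1.1, t.1.2, t.2.+1).

Definition upper (t : expo) := (q < t.1.2)%N.

(** Both boxes at once: passing from Q to M ([upper]) shrinks the bounds on the exponents of [x] and
    [z] by [u] and [v]. *)
Definition standard (t : expo) :=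
  [&& t.1.1 < p.+1 + (if upper t then 0 else u), t.1.2 < u + v
    & t.2 < r.+1 + (if upper t then 0 else v)]%N.

(** The exponent after rewriting [y ^ (u + v)] to [x ^ u z ^ v] as often as possible. It need not be
    [standard]; if it is not, the monomial is zero in A. *)
Definition normal (t : expo) : expo :=
  (t.1.1 + u * (t.1.2 %/ (u + v)), t.1.2 %% (u + v),
   t.2 + v * (t.1.2 %/ (u + v)))%N.

Definition monomials (d : nat) : seq expo :=
  [seq t <- [seq (ij, k) | ij <- [seq (i, j) | i <- iota 0 d.+1, j <- iota 0 d.+1],
                           k <- iota 0 d.+1] | deg t == d].

Definition std_basis (d : nat) : seq expo := [seq t <- monomials d | standard t].

Lemma mem_monomials d t : (t \in monomials d) = (deg t == d).
Proof.
rewrite mem_filter; apply: andb_idr => /eqP; case: t => [[i j] k] dt.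
have le_d n : (n <= d)%N -> n \in iota 0 d.+1 by rewrite mem_iota.
by apply: allpairs_f; [apply: allpairs_f|]; apply: le_d; move: dt; rewrite /deg /=; lia.
Qed.

Lemma mem_basis d t : (t \in std_basis d) = standard t && (deg t == d).
Proof. by rewrite mem_filter mem_monomials. Qed.

Lemma monomials_uniq d : uniq (monomials d).
Proof.
apply/filter_uniq/allpairs_uniq; rewrite ?iota_uniq //; last by case=> ? ? [].
by apply: allpairs_uniq; rewrite ?iota_uniq //; case=> ? ? [].
Qed.

Lemma basis_uniq d : uniq (std_basis d).
Proof. exact/filter_uniq/monomials_uniq. Qed.

(** Matrix entry of multiplication by [x + y + z] on A: a product with nonstandard normal form
    equals no basis element [t] and contributes zero. *)
Definition step (s t : expo) : K :=
  (normal (incx s) == t)%:R + (normal (incy s) == t)%:R + (normal (incz s) == t)%:R.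

Definition inner s t : K := (upper s == upper t)%:R * step s t.
Definition outer s t : K := (upper s != upper t)%:R * step s t.

Lemma normal_id (t : expo) : (t.1.2 < u + v)%N -> normal t = t.
Proof.
by case: t => [[i j] k] /= h; rewrite /normal /= divn_small // modn_small // !muln0 !addn0.
Qed.

Lemma standard_lt (t : expo) : standard t -> (t.1.2 < u + v)%N.
Proof. by case/and3P. Qed.

Hypothesis charK : [pchar K] =i pred0.
Hypotheses (uv : (u + v = q.+1 + w)%N) (w_gt0 : (0 < w)%N).

(** Rewriting never acts inside a box: only a [y]-step from the top layer of M triggers it, and that
    lands at [y]-exponent 0, outside M. *)
Lemma innerE s t : standard s -> standard t ->
  inner s t = (upper s == upper t)%:R *
    ((incx s == t)%:R + (incy s == t)%:R + (incz s == t)%:R).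
Proof.
move=> Ss St; rewrite /inner /step.
have [ut|] := eqVneq (upper s) (upper t); last by rewrite !mul0r.
have js := standard_lt Ss.
rewrite (@normal_id (incx s)) // (@normal_id (incz s)) //.
have [lt|ge] := ltnP s.1.2.+1 (u + v); first by rewrite (@normal_id (incy s)).
have e : s.1.2.+1 = (u + v)%N by lia.
have us : upper s by rewrite /upper; lia.
have -> : (normal (incy s) == t) = false.
  apply/negP=> /eqP tE; move: us; rewrite ut -tE /upper /normal /= e modnn; lia.
suff -> : (incy s == t) = false by [].
apply/negP=> /eqP tE; have := standard_lt St; rewrite -tE /=; lia.
Qed.

(** [o] is the offset of the box in the [y]-direction. The second clause ensures that every exponent
    of the block is reached as [j + o]. *)
Definition is_block (b : bool) (m n l o : nat) :=
  (forall i j k, standard (i, j + o, k)%N && (upper (i, j + o, k)%N == b)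
     = [&& i < m, j < n & k < l]%N) /\
  (forall t, standard t -> upper t = b -> (o <= t.1.2)%N).

Lemma lower_block : is_block false (p.+1 + u) q.+1 (r.+1 + v) 0.
Proof.
split=> // i j k; rewrite addn0 /standard /upper /=.
by case: (ltnP q j) => h; rewrite ?andbF ?andbT //=; lia.
Qed.

Lemma upper_block : is_block true p.+1 w r.+1 q.+1.
Proof.
split=> [i j k|t _ //]; rewrite /standard /upper /=.
have -> : (q < j + q.+1)%N by lia.
by rewrite !addn0 andbT; lia.
Qed.

Lemma sum_pick (A : seq expo) (F : expo -> K) (s0 : expo) : uniq A ->
  \sum_(s <- A) F s * (s == s0)%:R = if s0 \in A then F s0 else 0.
Proof.
move=> uA; case: ifP => [s0A|ns0].
  rewrite (bigD1_seq s0) //= eqxx mulr1 big1 ?addr0 // => s /negPf->.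
  by rewrite mulr0.
rewrite big_seq big1 // => s sA; case: eqP => [e|]; last by rewrite mulr0.
by rewrite -e sA in ns0.
Qed.

(** [inner] respects the boxes, so a kernel vector can be cut down to one of them; shifted by [o],
    it is killed by [mulxyz] inside the box, in degree [d - o]. *)
Lemma inner_injective_block b m n l o d (g : expo -> K) :
  is_block b m n l o -> (2 * d + 3 < m + n + l + 2 * o)%N ->
  (forall t, t \in std_basis d.+1 -> \sum_(s <- std_basis d) g s * inner s t = 0) ->
  forall s, s \in std_basis d -> upper s = b -> g s = 0.
Proof.
move=> [boxE ole] hd hg.
pose gb s := if (s \in std_basis d) && (upper s == b) then g s else 0.
pose G i j k := gb (i, j + o, k)%N.
move=> [[i j] k] sd ub; have := sd; rewrite mem_basis => /andP[Ss ds].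
have /= oj := ole _ Ss ub.
have od : (o <= d)%N by move: ds; rewrite /deg /=; lia.
suff /(_ i (j - o)%N k) : forall i j k, G i j k = 0.
  by rewrite /G /gb subnK // sd ub eqxx.
apply: (@mulxyz_injective _ charK m n l (d - o)); last 1 first.
- move=> {sd ub Ss ds oj} {}i {}j {}k im jn kl.
  have := boxE i j k; rewrite im jn kl /= => /andP[St /eqP ut].
  have gb0 t : (deg t == d) = false -> gb t = 0 by rewrite /gb mem_basis => ->; rewrite andbF.
  (* In any other degree the three predecessors lie outside degree [d], where [gb] is zero. *)
  have [dt|ndt] := eqVneq (deg (i, j + o, k)%N) d.+1; last first.
    rewrite /mulxyz /G; move: ndt; rewrite /deg /= => ndt.
    by case: i ndt {im St ut} => [|i]; case: j {jn} => [|j]; case: k {kl} => [|k] ndt;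
      rewrite ?gb0 ?addr0 // /deg /=; lia.
  have td : (i, j + o, k)%N \in std_basis d.+1 by rewrite mem_basis St dt eqxx.
  have sumE (f : expo -> expo) s0 : injective f -> f s0 = (i, j + o, k)%N ->
      \sum_(s <- std_basis d) gb s * (f s == (i, j + o, k)%N)%:R = gb s0.
    move=> fi fs0; under eq_bigr do rewrite -fs0 (inj_eq fi).
    by rewrite sum_pick ?basis_uniq // /gb; case: (s0 \in std_basis d).
  have sum0 (f : expo -> expo) :
      (forall s, s \in std_basis d -> upper s = b -> f s <> (i, j + o, k)%N) ->
      \sum_(s <- std_basis d) gb s * (f s == (i, j + o, k)%N)%:R = 0.
    move=> nf; rewrite big_seq big1 // => s sd; rewrite /gb sd /=.
    case: eqP => [us|]; last by rewrite mul0r.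
    by case: eqP => [/nf|]; [case | rewrite mulr0].
  rewrite -[RHS](hg _ td); transitivity (\sum_(s <- std_basis d)
      gb s * ((incx s == (i, j + o, k)%N)%:R + (incy s == (i, j + o, k)%N)%:R
              + (incz s == (i, j + o, k)%N)%:R)); last first.
    apply: eq_big_seq => s sd; have := sd; rewrite mem_basis => /andP[Ss _].
    by rewrite innerE // ut /gb sd /=; case: (upper s == b); rewrite ?mul1r // !mul0r mulr0.
  under eq_bigr do rewrite !mulrDr.
  rewrite !big_split /mulxyz /G /=; congr (_ + _ + _).
  + case: i sumE sum0 {im St ut dt td} => [|i] sumE sum0.
      by rewrite sum0 // => -[[? ?] ?] _ _ [].
    by rewrite (sumE _ (i, j + o, k)%N) // => -[[? ?] ?] [[? ?] ?] [-> -> ->].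
  + case: j sumE sum0 {jn St ut dt td} => [|j] sumE sum0.
      (* On the bottom face the [y]-predecessor would lie below the offset, hence outside the
         block. *)
      rewrite sum0 // => s; rewrite mem_basis => /andP[Ss _] us.
      by have := ole _ Ss us => + /(congr1 (fun t : expo => t.1.2)) /=; lia.
    by rewrite (sumE _ (i, j + o, k)%N) // => -[[? ?] ?] [[? ?] ?] [-> -> ->].
  + case: k sumE sum0 {kl St ut dt td} => [|k] sumE sum0.
      by rewrite sum0 // => -[[? ?] ?] _ _ [].
    by rewrite (sumE _ (i, j + o, k)%N) // => -[[? ?] ?] [[? ?] ?] [-> -> ->].
- move=> {sd ub Ss ds oj} {}i {}j {}k out; rewrite /G /gb mem_basis.
  case: ifP => // /andP[/andP[S1 d1] u1]; case/negP: out.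
  have := boxE i j k; rewrite S1 u1 => /esym/and3P[-> -> ->] /=.
  by move: d1; rewrite /deg /=; lia.
- lia.
Qed.

(** The transpose of [inner] is [contract] on each box, now in degree [d + 1 - o]. *)
Lemma inner_surjective_block b m n l o d (h : expo -> K) :
  is_block b m n l o -> (m + n + l + 2 * o < 2 * d + 5)%N ->
  (forall s, s \in std_basis d -> \sum_(t <- std_basis d.+1) inner s t * h t = 0) ->
  forall t, t \in std_basis d.+1 -> upper t = b -> h t = 0.
Proof.
move=> [boxE ole] hd hh.
pose hb t := if (t \in std_basis d.+1) && (upper t == b) then h t else 0.
pose H i j k := hb (i, j + o, k)%N.
have HE i j k : ~~ [&& i < m, j < n, k < l & i + j + o + k == d.+1]%N -> H i j k = 0.
  move=> out; rewrite /H /hb mem_basis.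
  case: ifP => // /andP[/andP[S1 d1] u1]; case/negP: out.
  have := boxE i j k; rewrite S1 u1 => /esym/and3P[-> -> ->] /=.
  by move: d1; rewrite /deg /=; lia.
move=> [[i j] k] td ub; have := td; rewrite mem_basis => /andP[St dt].
have /= oj := ole _ St ub.
have od : (o <= d.+1)%N by move: dt; rewrite /deg /=; lia.
suff /(_ i (j - o)%N k) : forall i j k, H i j k = 0.
  by rewrite /H /hb subnK // td ub eqxx.
apply: (@contract_injective _ charK m n l (d.+1 - o)); last 1 first.
- move=> {td ub St dt oj} {}i {}j {}k.
  have [|out] := boolP [&& i < m, j < n, k < l & i + j + o + k == d]%N; last first.
    by rewrite /contract !HE ?addr0 //; lia.
  case/and4P=> im jn kl /eqP dE.
  have := boxE i j k; rewrite im jn kl /= => /andP[Ss /eqP us].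
  have sd : (i, j + o, k)%N \in std_basis d by rewrite mem_basis Ss /deg /=; lia.
  have sumE t0 : \sum_(t <- std_basis d.+1) hb t * (t0 == t)%:R = hb t0.
    under eq_bigr do rewrite eq_sym.
    by rewrite sum_pick ?basis_uniq // /hb; case: (t0 \in _).
  rewrite -[RHS](hh _ sd); transitivity (\sum_(t <- std_basis d.+1)
      hb t * ((incx (i, j + o, k)%N == t)%:R + (incy (i, j + o, k)%N == t)%:R
              + (incz (i, j + o, k)%N == t)%:R)); last first.
    apply: eq_big_seq => t td; have := td; rewrite mem_basis => /andP[St _].
    rewrite innerE // us /hb td /= [b == _]eq_sym mulrC.
    by case: (upper t == b); rewrite ?mul1r // !(mul0r, mulr0).
  under eq_bigr do rewrite !mulrDr.
  by rewrite !big_split /= !sumE.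
- by move=> {td ub St dt oj} {}i {}j {}k out; apply: HE; lia.
- lia.
Qed.

(** Both boxes have [m + n + l + 2 * o = p + q + r + u + v + 3], because [u + v = q + 1 + w]; hence
    one degree bound serves both. *)
Lemma inner_injective d (g : expo -> K) : (2 * d < p + q + r + u + v)%N ->
  (forall t, t \in std_basis d.+1 -> \sum_(s <- std_basis d) g s * inner s t = 0) ->
  forall s, s \in std_basis d -> g s = 0.
Proof.
move=> hd hg s sd; case us: (upper s).
  by apply: (inner_injective_block upper_block _ hg sd us); lia.
by apply: (inner_injective_block lower_block _ hg sd us); lia.
Qed.

Lemma inner_surjective d (h : expo -> K) : (p + q + r + u + v < 2 * d.+1)%N ->
  (forall s, s \in std_basis d -> \sum_(t <- std_basis d.+1) inner s t * h t = 0) ->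
  forall t, t \in std_basis d.+1 -> h t = 0.
Proof.
move=> hd hh t td; case ut: (upper t).
  by apply: (inner_surjective_block upper_block _ hh td ut); lia.
by apply: (inner_surjective_block lower_block _ hh td ut); lia.
Qed.

(** Each degree excludes only the roots of one nonzero polynomial, and finitely many such
    polynomials multiply to a single one. *)
Lemma inner_pencil_maximal_rank (D : nat) :
  exists2 P : {poly K}, P != 0 & forall t, ~~ root P t ->
    forall d, (d < D)%N ->
      row_free (tabulate (std_basis d) (std_basis d.+1) (pencil inner outer t)) \/
      row_full (tabulate (std_basis d) (std_basis d.+1) (pencil inner outer t)).
Proof.
elim: D => [|D [P P0 hP]]; first by exists 1; rewrite ?oner_eq0.
pose X := tabulate (std_basis D) (std_basis D.+1) inner.
pose Y := tabulate (std_basis D) (std_basis D.+1) outer.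
suff [Q Q0 hQ] : exists2 Q : {poly K}, Q != 0 & forall t, ~~ root Q t ->
    row_free (t *: X + Y)%R \/ row_full (t *: X + Y)%R.
  exists (P * Q); first by rewrite mulf_neq0.
  move=> t; rewrite rootM negb_or => /andP[Pt Qt] d; rewrite ltnS leq_eqVlt.
  case/orP=> [/eqP->|]; last exact: hP.
  by rewrite !tabulate_pencil; apply: hQ.
have [lt|ge] := ltnP (2 * D) (p + q + r + u + v).
  have fX : row_free X.
    by apply/row_free_tabulate => [|g]; [exact: basis_uniq | exact: inner_injective].
  by have [Q Q0 hQ] := row_free_pencil Y fX; exists Q => // t /hQ; left.
have fX : row_full X.
  by apply: row_full_tabulate => [|h]; [exact: basis_uniq | apply: inner_surjective; lia].
by have [Q Q0 hQ] := row_full_pencil Y fX; exists Q => // t /hQ; right.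
Qed.

End Blocks.

(** * Congruence modulo an ideal *)

Section IdealMembership.
Variables (K : fieldType) (n k : nat) (gs : k.-tuple {mpoly K[n]}).

Lemma in_ideal0 : in_ideal gs 0.
Proof. by exists (fun=> 0); rewrite big1 // => j _; rewrite mul0r. Qed.

Lemma in_idealD f g : in_ideal gs f -> in_ideal gs g -> in_ideal gs (f + g).
Proof.
move=> [a ->] [b ->]; exists (fun j => a j + b j).
by rewrite -big_split; apply: eq_bigr => j _; rewrite mulrDl.
Qed.

Lemma in_idealM h f : in_ideal gs f -> in_ideal gs (h * f).
Proof.
move=> [a ->]; exists (fun j => h * a j).
by rewrite mulr_sumr; apply: eq_bigr => j _; rewrite mulrA.
Qed.

Lemma in_idealZ c f : in_ideal gs f -> in_ideal gs (c *: f).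
Proof. by rewrite -mul_mpolyC; apply: in_idealM. Qed.

Lemma in_idealN f : in_ideal gs f -> in_ideal gs (- f).
Proof. by rewrite -mulN1r; apply: in_idealM. Qed.

Lemma in_ideal_sum (I : eqType) (A : seq I) (F : I -> {mpoly K[n]}) :
  (forall i, i \in A -> in_ideal gs (F i)) -> in_ideal gs (\sum_(i <- A) F i).
Proof.
move=> AF; rewrite big_seq; apply: big_ind => //; first exact: in_ideal0.
exact: in_idealD.
Qed.

Lemma in_ideal_gen j : in_ideal gs (tnth gs j).
Proof.
exists (fun i => (i == j)%:R); rewrite (bigD1 j) //= eqxx mul1r big1 ?addr0 //.
by move=> i /negPf->; rewrite mul0r.
Qed.

Definition congr_ideal f g := in_ideal gs (f - g).

Lemma congr_ideal_refl f : congr_ideal f f.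
Proof. by rewrite /congr_ideal subrr; apply: in_ideal0. Qed.

Lemma congr_ideal_sym f g : congr_ideal f g -> congr_ideal g f.
Proof. by move=> fg; rewrite /congr_ideal -opprB; apply: in_idealN. Qed.

Lemma congr_ideal_trans f g h :
  congr_ideal f g -> congr_ideal g h -> congr_ideal f h.
Proof. by move=> fg /(in_idealD fg); rewrite /congr_ideal addrA subrK. Qed.

Lemma congr_idealD f f' g g' : congr_ideal f f' -> congr_ideal g g' ->
  congr_ideal (f + g) (f' + g').
Proof.
by move=> ff' gg'; rewrite /congr_ideal opprD addrACA; apply: in_idealD.
Qed.

Lemma congr_idealM h f g : congr_ideal f g -> congr_ideal (h * f) (h * g).
Proof. by rewrite /congr_ideal -mulrBr; apply: in_idealM. Qed.

Lemma congr_idealZ c f g : congr_ideal f g -> congr_ideal (c *: f) (c *: g).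
Proof. by rewrite /congr_ideal -scalerBr; apply: in_idealZ. Qed.

Lemma congr_ideal_sum (I : eqType) (A : seq I) (F G : I -> {mpoly K[n]}) :
  (forall i, i \in A -> congr_ideal (F i) (G i)) ->
  congr_ideal (\sum_(i <- A) F i) (\sum_(i <- A) G i).
Proof. by move=> FG; rewrite /congr_ideal -sumrB; apply: in_ideal_sum. Qed.

Lemma congr_ideal_mem f g : congr_ideal f g -> in_ideal gs f <-> in_ideal gs g.
Proof.
move=> fg; split=> h; first by have /(in_idealD h) := congr_ideal_sym fg; rewrite addrC subrK.
by have := in_idealD fg h; rewrite subrK.
Qed.
End IdealMembership.

(** * Monomials of [K[x,y,z]] as exponent triples *)

Section Monomials.
Variable K : fieldType.
Local Notation R := {mpoly K[3]}.
Local Notation i0 := (inord 0 : 'I_3).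
Local Notation i1 := (inord 1 : 'I_3).
Local Notation i2 := (inord 2 : 'I_3).

Definition mnm_of (t : expo) : 'X_{1..3} := [multinom nth 0%N [:: t.1.1; t.1.2; t.2] i | i < 3].
Definition expo_of (m : 'X_{1..3}) : expo := (m i0, m i1, m i2).
Definition mon (t : expo) : R := 'X_[mnm_of t].

Lemma mnm_ofK : cancel mnm_of expo_of.
Proof. by case=> [[i j] k]; rewrite /expo_of !mnmE !inordK. Qed.

Lemma expo_ofK : cancel expo_of mnm_of.
Proof.
move=> m; apply/mnmP=> i; rewrite mnmE /=.
by case: i => [[|[|[|]]] lt] //=; congr (m _); apply: val_inj; rewrite /= inordK.
Qed.

Lemma monM s t : mon s * mon t = mon (s.1.1 + t.1.1, s.1.2 + t.1.2, s.2 + t.2)%N.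
Proof.
rewrite /mon -mpolyXD; congr 'X_[_]; apply/mnmP=> i; rewrite mnmDE !mnmE /=.
by case: i => [[|[|[|]]] lt].
Qed.

Lemma monE t : mon t = 'X_i0 ^+ t.1.1 * 'X_i1 ^+ t.1.2 * 'X_i2 ^+ t.2.
Proof.
rewrite !mpolyXn -!mpolyXD; congr 'X_[_]; apply/mnmP=> i.
rewrite !mnmDE !mulmnE !mnm1E mnmE -!val_eqE /= !inordK //.
by case: i => [[|[|[|]]] lt] //=; rewrite ?(mul0n, mul1n, addn0, add0n).
Qed.

Lemma mdeg_mnm_of t : mdeg (mnm_of t) = deg t.
Proof. by rewrite mdegE 3!big_ord_recl big_ord0 !mnmE /= addn0 addnA. Qed.

Lemma mon_homog t : mon t \is (deg t).-homog.
Proof. by rewrite dhomogX; apply/eqP; apply: mdeg_mnm_of. Qed.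

Lemma mcoeff_mon s t : (mon s)@_(mnm_of t) = (s == t)%:R.
Proof. by rewrite mcoeffX (can_eq mnm_ofK). Qed.
End Monomials.
Arguments mon {K} t.

(** * The weak Lefschetz property *)

Section Gorenstein.
Variables (K : fieldType) (p q r u v w : nat).
Hypothesis charK : [pchar K] =i pred0.
Hypotheses (uv : (u + v = q.+1 + w)%N) (w_gt0 : (0 < w)%N) (u_gt0 : (0 < u)%N).
Local Notation R := {mpoly K[3]}.
Local Notation standard := (standard p q r u v).
Local Notation normal := (normal u v).
Local Notation std_basis := (std_basis p q r u v).
Local Notation upper := (upper q).
Local Notation inner := (@inner K q u v).
Local Notation outer := (@outer K q u v).
Local Notation step := (@step K u v).

(** Parametrised by [a = p + 1 + u], [b = u + v], [c = r + 1 + v] and [b - beta = q + 1], so that no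
    truncated subtraction occurs. *)
Definition gorenstein_gens : 5.-tuple R :=
  [tuple mon (p.+1 + u, 0, 0)%N;
         mon (0, u + v, 0)%N - mon (u, 0, v)%N;
         mon (0, 0, r.+1 + v)%N;
         mon (p.+1, q.+1, 0)%N;
         mon (0, q.+1, r.+1)%N].
Local Notation I := (in_ideal gorenstein_gens).
Local Notation "f '=~' g" := (congr_ideal gorenstein_gens f g) (at level 70).

Lemma nonstandard_in_ideal t : (t.1.2 < u + v)%N -> ~~ standard t -> I (mon t).
Proof.
case: t => [[i j] k] /= jlt.
have gen n (s : expo) : tnth gorenstein_gens (inord n) = mon s ->
    (s.1.1 <= i)%N -> (s.1.2 <= j)%N -> (s.2 <= k)%N -> I (mon (i, j, k)).
  case: s => [[si sj] sk] /= gE le1 le2 le3.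
  have -> : mon (i, j, k) = mon (i - si, j - sj, k - sk)%N * mon (si, sj, sk) :> R.
    by rewrite monM /= !subnK.
  by rewrite -gE; apply/in_idealM/in_ideal_gen.
rewrite /standard /upper /= jlt /= negb_and -!leqNgt.
case: (ltnP q j) => qj; rewrite ?addn0 => /orP[] le.
- by apply: (gen 3%N (p.+1, q.+1, 0%N)) => //; rewrite (tnth_nth 0) inordK.
- by apply: (gen 4%N (0%N, q.+1, r.+1)) => //; rewrite (tnth_nth 0) inordK.
- by apply: (gen 0%N (p.+1 + u, 0, 0)%N) => //; rewrite (tnth_nth 0) inordK.
- by apply: (gen 2%N (0, 0, r.+1 + v)%N) => //; rewrite (tnth_nth 0) inordK.
Qed.

Lemma uv_gt0 : (0 < u + v)%N.
Proof. by rewrite addn_gt0 u_gt0. Qed.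

Lemma congr_normal t : mon t =~ mon (normal t).
Proof.
case: t => [[i j] k]; rewrite /normal /=; set h := (j %/ (u + v))%N.
have monX s n : mon s ^+ n = mon (s.1.1 * n, s.1.2 * n, s.2 * n)%N :> R.
  elim: n => [|n IH]; last by rewrite exprS IH monM /= !mulnS.
  by rewrite expr0 !muln0 monE !expr0 !mulr1.
have -> : mon (i, j, k) = mon (i, j %% (u + v), k)%N * mon (0, u + v, 0)%N ^+ h :> R.
  by rewrite monX monM /= !mul0n !addn0 addnC mulnC -divn_eq.
have -> : mon (i + u * h, j %% (u + v), k + v * h)%N
        = mon (i, j %% (u + v), k)%N * mon (u, 0, v)%N ^+ h :> R.
  by rewrite monX monM /= mul0n addn0.
(* A difference of [h]-th powers is a multiple of the difference of the bases, here the binomial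
   generator. *)
apply: congr_idealM; rewrite /congr_ideal subrXX mulrC; apply: in_idealM.
have := in_ideal_gen gorenstein_gens (inord 1).
by rewrite (tnth_nth 0) inordK.
Qed.

Lemma normal_lt t : ((normal t).1.2 < u + v)%N.
Proof. by rewrite /normal /= ltn_mod uv_gt0. Qed.

Lemma normal_shift i j k : normal (i, j + (u + v), k)%N = normal (i + u, j, k + v)%N.
Proof.
rewrite /normal /= divnDr ?dvdnn // divnn uv_gt0 modnDr.
by rewrite !mulnDr !muln1 ![(_ * _ + _)%N]addnC !addnA.
Qed.

Lemma deg_normal t : deg (normal t) = deg t.
Proof.
case: t => [[i j] k]; rewrite /deg /normal /=.
by move: (j %/ _)%N (j %% _)%N (divn_eq j (u + v)) => h l ->; rewrite mulnDr; lia.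
Qed.

Lemma congr_basis d t : deg t = d ->
  mon t =~ \sum_(s <- std_basis d) (normal t == s)%:R *: mon s.
Proof.
move=> dt; apply: congr_ideal_trans (congr_normal t) _.
have [St|nSt] := boolP (standard (normal t)).
  have sd : normal t \in std_basis d by rewrite mem_basis St deg_normal dt eqxx.
  rewrite (bigD1_seq (normal t)) ?basis_uniq //= eqxx scale1r big1 ?addr0 => [|s].
    exact: congr_ideal_refl.
  by rewrite eq_sym => /negPf->; rewrite scale0r.
rewrite big_seq big1 => [|s]; last first.
  rewrite mem_basis => /andP[Ss _]; case: eqP => [e|]; last by rewrite scale0r.
  by rewrite e Ss in nSt.
by rewrite /congr_ideal subr0; apply: nonstandard_in_ideal nSt; apply: normal_lt.
Qed.

Lemma homog_span d f : f \is d.-homog ->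
  exists g : expo -> K, f =~ \sum_(s <- std_basis d) g s *: mon s.
Proof.
move/dhomogP=> hf.
exists (fun s => \sum_(m <- msupp f) f@_m * (normal (expo_of m) == s)%:R).
rewrite [X in X =~ _]mpolyE; under [X in _ =~ X]eq_bigr do rewrite scaler_suml.
rewrite exchange_big /=; apply: congr_ideal_sum => m mf.
under [X in _ =~ X]eq_bigr do rewrite -scalerA.
rewrite -scaler_sumr; apply: congr_idealZ.
have <- : mon (expo_of m) = 'X_[m] :> R by rewrite /mon expo_ofK.
by apply: congr_basis; rewrite -mdeg_mnm_of expo_ofK; apply: hf.
Qed.

(** The coefficient of [t] in the normal form of [f], written directly in the coefficients of [f] so
    that linearity is plain. Summing over degree [deg t] loses nothing since [normal] preserves
    degrees. *)
Definition nf_coord (t : expo) (f : R) : K :=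
  \sum_(s <- monomials (deg t)) f@_(mnm_of s) * (normal s == t)%:R.

Lemma coord_is_linear t : scalar (nf_coord t).
Proof.
move=> a f g; rewrite /nf_coord mulr_sumr -big_split; apply: eq_bigr => s _ /=.
by rewrite mcoeffD mcoeffZ mulrDl mulrA.
Qed.

HB.instance Definition _ t :=
 GRing.isLinear.Build K R K *%R (nf_coord t) (coord_is_linear t).

Lemma coord_mon t s : nf_coord t (mon s) = (normal s == t)%:R.
Proof.
rewrite /nf_coord; under eq_bigr do rewrite mcoeff_mon eq_sym mulrC.
rewrite sum_pick ?monomials_uniq // mem_monomials.
by case: eqP => // ndeg; case: eqP => // nst; case: ndeg; rewrite -nst deg_normal.
Qed.

(** This plays the part of Buchberger's criterion. By linearity only monomial multiples of
    generators matter: the two terms of the binomial get equal normal forms, and multiples of the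
    other generators get nonstandard ones. *)
Lemma coord_ideal t f : standard t -> I f -> nf_coord t f = 0.
Proof.
move=> St [a ->]; rewrite raddf_sum big1 // => j _ /=.
rewrite [a j]mpolyE mulr_suml raddf_sum big1 // => m _ /=.
rewrite -scalerAl linearZ /=; apply/eqP; rewrite mulf_eq0; apply/orP; right; apply/eqP.
have <- : mon (expo_of m) = 'X_[m] :> R by rewrite /mon expo_ofK.
move: (expo_of m) => [[mi mj] mk] {f a m}.
have out s : ~~ standard (normal s) -> nf_coord t (mon s) = 0.
  by rewrite coord_mon; case: eqP => // ->; rewrite St.
have uv0 := uv_gt0.
rewrite (tnth_nth 0) /gorenstein_gens; case: j => [[|[|[|[|[|//]]]]] lt] /=.
- rewrite monM out //; apply/negP=> /and3P[+ _ _]; rewrite /normal /=.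
  by case: ifP => _; move: (u * _)%N => e; lia.
- rewrite mulrBr linearB /= !monM /= !coord_mon.
  by rewrite !addn0 normal_shift subrr.
- rewrite monM out //; apply/negP=> /and3P[_ _]; rewrite /normal /=.
  by case: ifP => _; move: (v * _)%N => e; lia.
- rewrite monM out // /standard /normal /upper /= !addn0.
  (* Without rewriting, the product is [upper] with [x]-exponent above [p]; a single rewriting
     already raises the [x]-exponent to at least [p + 1 + u], too large for either box. *)
  have := divn_eq (mj + q.+1) (u + v); case: (_ %/ _)%N => [|h] E.
    rewrite mul0n add0n in E; rewrite -E.
    have -> : (q < mj + q.+1)%N by lia.
    by apply/negP=> /and3P[]; lia.
  apply/negP=> /and3P[l1 _ l2]; move: l1 l2; rewrite !mulnS.
  by case: ifP => _; move: (u * h)%N (v * h)%N => e1 e2; lia.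
- rewrite monM out // /standard /normal /upper /= !addn0.
  have := divn_eq (mj + q.+1) (u + v); case: (_ %/ _)%N => [|h] E.
    rewrite mul0n add0n in E; rewrite -E.
    have -> : (q < mj + q.+1)%N by lia.
    by apply/negP=> /and3P[]; lia.
  apply/negP=> /and3P[l1 _ l2]; move: l1 l2; rewrite !mulnS.
  by case: ifP => _; move: (u * h)%N (v * h)%N => e1 e2; lia.
Qed.

Lemma basis_independent d (g : expo -> K) :
  I (\sum_(s <- std_basis d) g s *: mon s) -> forall s, s \in std_basis d -> g s = 0.
Proof.
move=> Ig s sd; have := sd; rewrite mem_basis => /andP[Ss _].
rewrite -(coord_ideal Ss Ig) raddf_sum /=.
transitivity (\sum_(t <- std_basis d) g t * (t == s)%:R).
  by rewrite sum_pick ?basis_uniq // sd.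
apply: eq_big_seq => t; rewrite mem_basis => /andP[St _].
by rewrite linearZ /= coord_mon normal_id //; case/and3P: St.
Qed.

(** Here [z] is a scalar. The factor [z ^ u] on M absorbs the coefficient of the form when crossing
    from Q to M. On the return by [y ^ (u + v) = x ^ u z ^ v], that factor and the coefficient
    together match the [z ^ (2 * u)] gained from the new [x]-exponent. *)
Definition weight (z : K) (s : expo) : K :=
  z ^+ (2 * s.1.1) * z ^+ (if upper s then u else 0).

Definition linear_form (z : K) : R :=
  z ^+ u *: (z ^+ 2 *: mon (1, 0, 0)%N + mon (0, 1, 0)%N + mon (0, 0, 1)%N).

(* Moves between the two boxes cost no power of z, moves inside a box cost
   z ^+ u: this is the point of the weights. *)
Lemma linear_form_basis z d s : s \in std_basis d ->
  linear_form z * (weight z s *: mon s) =~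
  \sum_(t <- std_basis d.+1) (pencil inner outer (z ^+ u) s t * weight z t) *: mon t.
Proof.
rewrite mem_basis => /andP[Ss /eqP ds].
have -> : linear_form z * (weight z s *: mon s) =
    (weight z s * z ^+ (u + 2)) *: mon (incx s) + (weight z s * z ^+ u) *: mon (incy s)
    + (weight z s * z ^+ u) *: mon (incz s).
  rewrite /linear_form -scalerAr -scalerAl !mulrDl -scalerAl !monM !scalerDr !scalerA.
  by rewrite !add0n !add1n exprD mulrA; case: s {Ss ds} => [[]].
have pencilE t : pencil inner outer (z ^+ u) s t =
    (if upper s == upper t then z ^+ u else 1) * step s t.
  by rewrite /pencil /inner /outer; case: eqP => _ /=; ring.
have dirE (c : K) (inc : expo) : deg inc = d.+1 ->
    (normal inc \in std_basis d.+1 -> weight z s * c =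
      (if upper s == upper (normal inc) then z ^+ u else 1) * weight z (normal inc)) ->
    (weight z s * c) *: mon inc =~ \sum_(t <- std_basis d.+1)
      ((if upper s == upper t then z ^+ u else 1) * (normal inc == t)%:R * weight z t) *: mon t.
  move=> dinc hc; apply: congr_ideal_trans (congr_idealZ _ (congr_basis dinc)) _.
  rewrite scaler_sumr; apply: congr_ideal_sum => t td; rewrite scalerA.
  have [e|_] := eqVneq (normal inc) t; last by rewrite !(mulr0, mul0r); apply: congr_ideal_refl.
  by rewrite !mulr1 hc ?e //; apply: congr_ideal_refl.
have js : (s.1.2 < u + v)%N by case/and3P: Ss.
under [X in _ =~ X]eq_bigr do rewrite pencilE /step !mulrDr !mulrDl !scalerDl.
rewrite !big_split /=; apply: congr_idealD; first apply: congr_idealD.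
- apply: dirE => [|_]; first by rewrite -ds /deg /=; lia.
  rewrite normal_id // eqxx /weight /incx /upper /= mulnS !exprD; ring.
- apply: dirE => [|]; first by rewrite -ds /deg /=; lia.
  have [lt _|ge] := ltnP s.1.2.+1 (u + v).
    rewrite normal_id // /weight /incy /upper /=.
    have [e|ne] := eqVneq q s.1.2.
      by rewrite e ltnn ltnSn /= expr0; ring.
    have -> : (q < s.1.2.+1)%N = (q < s.1.2)%N by lia.
    by rewrite eqxx; ring.
  have e : s.1.2.+1 = (u + v)%N by lia.
  have us : (q < s.1.2)%N by lia.
  rewrite /normal /= e divnn uv_gt0 modnn !muln1 => _; rewrite /weight /upper /= us /=.
  by rewrite mulnDr [(2 * u)%N]mul2n -addnn !exprD; ring.
- apply: dirE => [|_]; first by rewrite -ds /deg /=; lia.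
  by rewrite normal_id // eqxx /weight /incz /upper /=; ring.
Qed.

Lemma linear_form_homog z : linear_form z \is 1.-homog.
Proof.
apply/rpredZ/rpredD; first apply: rpredD; first apply: rpredZ.
- exact: (mon_homog _ (1, 0, 0)%N).
- exact: (mon_homog _ (0, 1, 0)%N).
- exact: (mon_homog _ (0, 0, 1)%N).
Qed.

Lemma homog_span_weighted z d f : z != 0 -> f \is d.-homog ->
  exists g : expo -> K, f =~ \sum_(s <- std_basis d) g s *: (weight z s *: mon s).
Proof.
move=> z0 /homog_span[g fg]; exists (fun s => g s / weight z s).
apply: congr_ideal_trans fg _; apply: congr_ideal_sum => s _.
by rewrite scalerA divfK ?mulf_neq0 ?expf_neq0 //; apply: congr_ideal_refl.
Qed.

Lemma gorenstein_WLP : has_WLP gorenstein_gens.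
Proof.
(* The sum of the side bounds exceeds every degree in which the basis is nonempty. *)
pose D := (p.+1 + u + (u + v) + (r.+1 + v))%N.
have [P P0 hP] := inner_pencil_maximal_rank p r charK uv w_gt0 D.
have [z z0 Pz] := natrX_nonroot charK u_gt0 P0.
have w0 s : weight z s != 0 by rewrite mulf_neq0 ?expf_neq0.
exists (linear_form z) => [|d]; first exact: linear_form_homog.
pose X := pencil inner outer (z ^+ u).
(* In the weighted basis the linear form has matrix [pencil inner outer (z ^ u)]. *)
have LE g : linear_form z * (\sum_(s <- std_basis d) g s *: (weight z s *: mon s)) =~
    \sum_(t <- std_basis d.+1) ((\sum_(s <- std_basis d) g s * X s t) * weight z t) *: mon t.
  rewrite mulr_sumr; under [X in _ =~ X]eq_bigr do rewrite mulr_suml scaler_suml.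
  rewrite exchange_big /=; apply: congr_ideal_sum => s sd; rewrite -scalerAr.
  under eq_bigr do rewrite -mulrA -scalerA.
  by rewrite -scaler_sumr; apply/congr_idealZ/linear_form_basis.
have [fX|fX] : row_free (tabulate (std_basis d) (std_basis d.+1) X) \/
               row_full (tabulate (std_basis d) (std_basis d.+1) X).
(* From degree [D] on the target is zero, so surjectivity is automatic. *)
- have [/(hP _ Pz)//|ge] := ltnP d D; right.
  rewrite /row_full eqn_leq rank_leq_col.
  suff -> : std_basis d.+1 = [::] by [].
  case E: (std_basis d.+1) => [//|t A]; have : t \in std_basis d.+1 by rewrite E mem_head.
  rewrite mem_basis /standard /deg; move: ge; rewrite /D; case: ifP => _; lia.
- left=> f /(homog_span_weighted z0)[g fg] /(congr_ideal_mem (congr_idealM _ fg)).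
  move/(congr_ideal_mem (LE g))/basis_independent => g0.
  apply/(congr_ideal_mem fg); rewrite big_seq big1; first exact: in_ideal0.
  move=> s sd; suff -> : g s = 0 by rewrite scale0r.
  apply: (row_free_tabulate _ _ (basis_uniq _ _ _ _ _ _)).1 fX _ _ _ sd => t td.
  by have /eqP := g0 t td; rewrite mulf_eq0 (negPf (w0 t)) orbF => /eqP.
- right=> f /(homog_span_weighted z0)[g fg].
  have [a aE] := row_full_solve g (basis_uniq _ _ _ _ _ _) fX.
  exists (\sum_(s <- std_basis d) a s *: (weight z s *: mon s)).
    rewrite big_seq; apply: rpred_sum => s; rewrite mem_basis => /andP[_ /eqP <-].
    by do 2 apply: rpredZ; apply: mon_homog.
  apply: (congr_ideal_trans fg); apply/congr_ideal_sym/(congr_ideal_trans (LE a)).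
  apply: congr_ideal_sum => t td; rewrite aE // scalerA; exact: congr_ideal_refl.
Qed.
End Gorenstein.

Theorem theorem4p3 (K : fieldType) (a b c beta gamma : nat) :
  [pchar K] =i pred0 ->
  (c <= a)%N -> (2 <= c)%N ->
  (1 <= beta)%N -> (beta <= b - 1)%N ->
  (maxn 1 (b + 1 - a) <= gamma)%N -> (gamma <= minn (b - 1) (c - 1))%N ->
  [\/ a = 4%N, b = 4%N | c = 4%N] ->
  has_WLP (thm_gens K a b c beta gamma).
Proof.
move=> charK _ c2 b1 b2 g1 g2 _.
(* The bounds on [beta] and [gamma] make [a + gamma - b], [b - beta] and [c - gamma] positive, so
   their predecessors lose nothing; [w] is [beta]. *)
suff -> : thm_gens K a b c beta gamma = gorenstein_gens K (a + gamma - b).-1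
    (b - beta).-1 (c - gamma).-1 (b - gamma) gamma.
  by apply: (@gorenstein_WLP _ _ _ _ _ _ beta) => //; lia.
apply/val_inj => /=; rewrite !monE /= !expr0 !mul1r !mulr1 !prednK ?subnK; try lia.
by have -> : (a + gamma - b + (b - gamma) = a)%N by lia.
Qed.
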